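(* Let $\ell_1,\ell_2\in\mathbb{N}\setminus\{1\}$ satisfy $\gcd(\ell_1,\ell_2)=1$, and let $$p(x,y):=xy\bigl(x^{\ell_1}-y^{\ell_2}\bigr).$$ Then, for every $n\ge\max\{\ell_1+2,\ell_2+2\}$, there exists a truncated sequence $\beta^{(2n)}$ having the $k$-extension property relative to $\{1,p,-p\}$ for every $k\in\mathbb{N}_0$, but admitting no $\mathcal{Z}_p$-representing measure.
   Context: Here $\mathbb{N}=\{1,2,\ldots\}$, $\mathbb{N}_0=\mathbb{N}\cup\{0\}$, $\mathcal{P}_m=\{f\in\mathbb{R}[x,y]:\deg f\le m\}$, and $\mathcal{Z}_p=\{(x,y)\in\mathbb{R}^2:p(x,y)=0\}$. A truncated (bivariate) sequence of degree $2n$ is a family of real numbers $\beta\equiv\beta^{(2n)}=\{\beta_{i,j}\}_{i,j\in\mathbb{N}_0,\,i+j\le 2n}$. Its Riesz functional is the linear map $L_\beta:\mathcal{P}_{2n}\to\mathbb{R}$ with $L_\beta(x^iy^j)=\beta_{i,j}$. Let $\mathcal{B}_m$ denote the set of monomials of degree at most $m$. The moment matrix $M(n)\equiv M(n;\beta)$ is the symmetric matrix indexed by $\mathcal{B}_n\times\mathcal{B}_n$ whose entry at monomials $(u,v)$ is $L_\beta(uv)$. For a polynomial $f$ of degree $\delta\le 2n$, the localizing matrix $M_f(n)\equiv M_f(n;\beta)$ is the symmetric matrix indexed by $\mathcal{B}_{n-\lceil\delta/2\rceil}\times\mathcal{B}_{n-\lceil\delta/2\rceil}$ whose entry at $(u,v)$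 is $L_\beta(fuv)$. For $k\in\mathbb{N}_0$, a positive extension of $M(n)$ of order $n+k$ is a moment matrix $M(n+k)\succeq 0$ (of some truncated sequence of degree $2(n+k)$) whose principal submatrix indexed by $\mathcal{B}_n$ equals $M(n)$. The sequence $\beta^{(2n)}$ has the $k$-extension property relative to $\{1,p,-p\}$ if $M(n)$ admits a positive extension $M(n+k)$ such that $M_{p}(n+k)\succeq 0$ and $M_{-p}(n+k)\succeq 0$. A $\mathcal{Z}_p$-representing measure for $\beta^{(2n)}$ is a positive Borel measure $\mu$ on $\mathbb{R}^2$ supported on $\mathcal{Z}_p$ with $\beta_{i,j}=\int x^iy^j\,d\mu$ for all $i+j\le 2n$. *)

(* Defs.v *)
From HB Require Import structures.
From mathcomp Require Import all_boot all_order all_algebra.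
From mathcomp Require mpoly.

Set Implicit Arguments.
Unset Strict Implicit.
Unset Printing Implicit Defensive.

Import Order.TTheory GRing.Theory Num.Theory.
Local Open Scope ring_scope.

(* The notations of mpoly are incompatible with those of mathcomp.analysis, so
   they are kept inside this module; outside it, Import -(notations) mpoly
   gives access to the structures on {mpoly R[2]}. *)
Module Moments.
Import mpoly.

(* The multi-exponent m stands for the monomial x^(m 0) y^(m 1). *)
Definition monomial (d : nat) : finType := 'X_{1..2 < d.+1}.

Definition expx (d : nat) (m : monomial d) : nat := (m : 'X_{1..2}) ord0.
Definition expy (d : nat) (m : monomial d) : nat := (m : 'X_{1..2}) ord_max.

Definition truncseq (R : realFieldType) (d : nat) : Type :=
  {ffun monomial d -> R}.

Notation polyxy R := {mpoly R[2]}.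

Definition varX (R : realFieldType) : polyxy R := 'X_ord0.
Definition varY (R : realFieldType) : polyxy R := 'X_ord_max.

Definition mon (R : realFieldType) (d : nat) (m : monomial d) : polyxy R :=
  'X_[m].

(* 0 for the zero polynomial *)
Definition totdeg (R : realFieldType) (f : polyxy R) : nat := (msize f).-1.

Definition evalxy (R : realFieldType) (f : polyxy R) (a : R * R) : R :=
  f.@[tnth [tuple a.1; a.2]].

(* Meaningful for polynomials of degree at most d; the coefficients of f of
   degree greater than d are ignored. *)
Definition riesz (R : realFieldType) (d : nat) (b : truncseq R d)
    (f : polyxy R) : R :=
  \sum_(m : monomial d) f@_m * b m.

Lemma riesz_mon (R : realFieldType) (d : nat) (b : truncseq R d)
    (m : monomial d) : riesz b (mon R m) = b m.
Proof.
rewrite /riesz (bigD1 m) //= big1 ?addr0 => [|k km].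
  by rewrite mcoeffX eqxx mul1r.
by move: km; rewrite mcoeffX -val_eqE eq_sym => /negPf /= ->; rewrite mul0r.
Qed.

Lemma riesz_is_linear (R : realFieldType) (d : nat) (b : truncseq R d)
    (c : R) (f g : polyxy R) :
  riesz b (c *: f + g) = c * riesz b f + riesz b g.
Proof.
rewrite /riesz mulr_sumr -big_split; apply: eq_bigr => m _ /=.
by rewrite mcoeffD mcoeffZ mulrDl mulrA.
Qed.

Definition momentmx (R : realFieldType) (n : nat) (b : truncseq R n.*2) :
    'M[R]_#|monomial n| :=
  \matrix_(i, j) riesz b (mon R (enum_val i) * mon R (enum_val j)).

Definition locsize (R : realFieldType) (n : nat) (f : polyxy R) : nat :=
  (n - uphalf (totdeg f))%N.

(* Meaningful when totdeg f <= 2 n. *)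
Definition localmx (R : realFieldType) (n : nat) (b : truncseq R n.*2)
    (f : polyxy R) : 'M[R]_#|monomial (locsize n f)| :=
  \matrix_(i, j) riesz b (f * mon R (enum_val i) * mon R (enum_val j)).

Definition psd (R : realFieldType) (N : nat) (A : 'M[R]_N) : Prop :=
  A^T = A /\ forall v : 'cV[R]_N, 0 <= (v^T *m A *m v) ord0 ord0.

Lemma widen_monomial_subproof (n k : nat) (m : monomial n) :
  (mdeg m < (n + k).+1)%N.
Proof. by apply: leq_trans (bmdeg m) _; rewrite ltnS leq_addr. Qed.

Definition widen_monomial (n k : nat) (m : monomial n) : monomial (n + k) :=
  BMultinom (widen_monomial_subproof k m).

Definition widen_index (n k : nat) (i : 'I_#|monomial n|) :
    'I_#|monomial (n + k)| :=
  enum_rank (widen_monomial k (enum_val i)).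

Definition positive_extension (R : realFieldType) (n k : nat)
    (b : truncseq R n.*2) (b' : truncseq R (n + k).*2) : Prop :=
  psd (momentmx b') /\
  mxsub (@widen_index n k) (@widen_index n k) (momentmx b') = momentmx b.

Definition extension_property (R : realFieldType) (n : nat) (p : polyxy R)
    (b : truncseq R n.*2) (k : nat) : Prop :=
  exists b' : truncseq R (n + k).*2,
    [/\ positive_extension b b', psd (localmx b' p) & psd (localmx b' (- p))].

End Moments.
Export Moments.

From mathcomp Require Import all_classical all_reals all_analysis.
Import numFieldNormedType.Exports.
Local Open Scope classical_set_scope.

(* R^2 with its Borel sigma-algebra *)
Notation borel2 R := (g_sigma_algebraType (@open (R * R)%type)).

Definition zeroset (R : realType) (p : polyxy R) : set (R * R) :=
  [set a | evalxy p a = 0].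

(* The zero set of p is closed, so "supported on" it means that its
   complement is a null set. *)
Definition representing_measure (R : realType) (n : nat) (p : polyxy R)
    (b : truncseq R n.*2) (mu : {measure set (borel2 R) -> \bar R}) : Prop :=
  mu (~` zeroset p) = 0%E /\
  forall m : monomial n.*2,
    let f (a : R * R) := ((a.1 ^+ expx m * a.2 ^+ expy m)%:E)%E in
    mu.-integrable setT f /\ ((b m)%:E = \int[mu]_a f a)%E.

(* Main.v *)
From HB Require Import structures.
Require Import Defs.
From mathcomp Require Import all_boot all_order all_algebra.
From mathcomp Require Import all_classical all_reals all_analysis.
From mathcomp Require Import lra ring zify.
Import -(notations) mpoly.

Import Order.TTheory GRing.Theory Num.Theory.
Import numFieldNormedType.Exports.
Local Open Scope ring_scope.
Set Implicit Arguments.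
Unset Strict Implicit.
Unset Printing Implicit Defensive.

(** Write [Z] for the zero set of [p = x y (x^l1 - y^l2)]: the two axes and
    the monomial curve [t |-> (t^l2, t^l1)], three branches through the origin.
    The sequence is the restriction to degree [2n] of a single linear functional
    [L] on the whole polynomial ring that vanishes on the ideal [(p)] and is
    nonnegative on squares.  Truncating [L] at degree [2(n+k)] then gives the
    extension of order [n+k], its localizing matrices at [p] and [-p] being
    zero.  What rules out a measure is a polynomial [f] of degree 4 that is
    nonnegative on [Z] although [L f < 0].

    The polynomial is [f = x^2 + y^2 + 3xy + 9^(l1+l2) (x^4 + y^4)].  Its
    quadratic part is indefinite, but it is negative only around the direction
    of the antidiagonal, whereas every branch of [Z] leaves the origin
    tangentially to an axis, as [l1 <> l2]; far from the origin the quartic term dominates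
    ([separating_poly_ge0]).  On the other hand [f] is not a sum of squares
    modulo [p]: [p] vanishes to order at least 4 at the origin, so the
    quadratic part of [f] would itself be a sum of squares.

    The functional exploits exactly this.  The map [g |-> [t^2] g(t,-t)] kills
    [(p)] and takes the value [-1] at [f].  On a square [g^2], with
    [g(t,-t) = a + b t + c t^2 + ...], it equals [b^2 + 2ac], and the cross term
    must be compensated.  The term in [a = g(0,0)] is absorbed by a large
    multiple of the point evaluation at the origin, which does not change [L f].
    The term in [c] is absorbed by a small multiple of a functional that is
    strongly positive along each branch: the log-normal functional
    [t^k |-> 5^(k^2)] of one variable, whose value at [q^2] controls every
    coefficient of [q] ([lognormal_sqr_coef]).  This suffices because the three
    restrictions of [g] to the branches determine its second-order jet, hence
    [c] ([antidiagonal_coef2]); for the coefficient of [xy] this uses that [l1]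
    and [l2] are coprime and at least 2.  Since the point mass is free, the
    multiple of the branch functionals can be taken small enough that [L f]
    stays negative. *)

(** * The log-normal functional *)

Definition natdist (i j : nat) : nat := (i - j + (j - i))%N.

Lemma sum_geometric5 (R : realFieldType) (N : nat) :
  \sum_(i < N) (5^-1 : R) ^+ (N - i) = (1 - 5^-1 ^+ N) / 4.
Proof.
elim: N => [|N IH]; first by rewrite big_ord0 expr0 subrr mul0r.
rewrite big_ord_recr /= subSnn.
under eq_bigr => i _ do rewrite subSn 1?ltnW // exprS.
by rewrite -mulr_sumr IH expr1 exprS; move: (_ ^+ N) => a; field.
Qed.

(** The kernel [5^(-(i-j)^2)] is close enough to the identity that its quadratic
    form dominates half the sum of the squares.  The weights
    [1/2 + (5/4) 5^(i-N)] make the induction on [N] close: enlarging the matrix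
    costs the entry [i] at most [5^(i-N) (u_i)^2], which is precisely what its
    weight loses, and the new diagonal entry keeps the weight [3/4]. *)
Lemma gaussian_toeplitz_ge (R : realFieldType) (N : nat) (u : nat -> R) :
  \sum_(i < N) (2^-1 + 5 / 4 * 5^-1 ^+ (N - i)) * u i ^+ 2 <=
  \sum_(i < N) \sum_(j < N) 5^-1 ^+ (natdist i j ^ 2) * (u i * u j).
Proof.
elim: N => [|N IH]; first by rewrite !big_ord0.
rewrite !big_ord_recr /=.
under [X in _ <= X + _]eq_bigr => i _ do rewrite big_ord_recr /=.
rewrite big_split /= /natdist subnn addn0 expr0 mul1r subSnn expr1.
under [X in _ <= _ + (X + _)]eq_bigr => i _ do
  rewrite addnC mulrC (mulrC (u N)) mulrC.
set A := \sum_(i < N) \sum_(j < N) _ in IH *.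
set B := \sum_(i < N) _ * (_ * u N).
have HB : - \sum_(i < N) (5^-1 : R) ^+ (N - i) * (u i ^+ 2 + u N ^+ 2) <= B + B.
  rewrite -big_split /= -sumrN; apply: ler_sum => i _.
  have -> : (i - N)%N = 0%N by apply/eqP; rewrite subn_eq0 ltnW.
  rewrite add0n.
  set a := _ ^+ (N - i); set b := _ ^+ (_ ^ 2).
  have b0 : 0 <= b by rewrite exprn_ge0 // invr_ge0.
  have ba : b <= a.
    apply: ler_wiXn2l; [by rewrite invr_ge0|by lra|].
    by rewrite -mulnn leq_pmulr // subn_gt0.
  have := sqr_ge0 (u i + u N); nra.
have HA : \sum_(i < N) (2^-1 + 5 / 4 * 5^-1 ^+ (N - i)) * u i ^+ 2 =
   \sum_(i < N) (2^-1 + 5 / 4 * 5^-1 ^+ (N.+1 - i)) * u i ^+ 2 +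
   \sum_(i < N) (5^-1 : R) ^+ (N - i) * u i ^+ 2.
  rewrite -big_split; apply: eq_bigr => i _ /=.
  by rewrite subSn 1?ltnW // (exprS 5^-1); move: (5^-1 ^+ _) => a; field.
move: IH; rewrite HA => IH.
have HC : \sum_(i < N) (5^-1 : R) ^+ (N - i) * (u i ^+ 2 + u N ^+ 2) =
   \sum_(i < N) (5^-1 : R) ^+ (N - i) * u i ^+ 2 +
   (1 - 5^-1 ^+ N) / 4 * u N ^+ 2.
  under eq_bigr => i _ do rewrite mulrDr.
  by rewrite big_split /= -mulr_suml sum_geometric5.
move: HB; rewrite HC.
have := sqr_ge0 (u N).
have : 0 <= (5^-1 : R) ^+ N by rewrite exprn_ge0 // invr_ge0.
nra.
Qed.

(** The value at [t^k] is the [k]-th moment of the log-normal law with location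
    [0] and variance parameter [2 ln 5], a law not determined by its moments. *)
Definition lognormal (R : realFieldType) (q : {poly R}) : R :=
  \sum_(i < size q) q`_i * 5 ^+ (i ^ 2).

Lemma lognormal_widen (R : realFieldType) (q : {poly R}) N :
  (size q <= N)%N -> lognormal q = \sum_(i < N) q`_i * 5 ^+ (i ^ 2).
Proof.
move=> le_qN; rewrite /lognormal.
rewrite (big_ord_widen N (fun i => q`_i * 5 ^+ (i ^ 2))) //.
rewrite big_mkcond; apply: eq_bigr => i _; case: ltnP => // qi.
by rewrite nth_default ?mul0r.
Qed.

Lemma lognormal_is_scalar (R : realFieldType) : scalar (@lognormal R).
Proof.
move=> c q r; pose N := maxn (size q) (size r).
have le_qN : (size q <= N)%N by rewrite leq_maxl.
have le_rN : (size r <= N)%N by rewrite leq_maxr.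
rewrite !(@lognormal_widen _ _ N) //; last first.
  rewrite (leq_trans (size_polyD _ _)) // geq_max le_rN.
  by rewrite (leq_trans (size_scale_leq _ _)).
rewrite mulr_sumr -big_split; apply: eq_bigr => i _ /=.
by rewrite coefD coefZ mulrDl mulrA.
Qed.

HB.instance Definition _ (R : realFieldType) :=
  GRing.isLinear.Build R {poly R} R _ (@lognormal R) (@lognormal_is_scalar R).

Lemma lognormalXn (R : realFieldType) k :
  lognormal ('X^k : {poly R}) = 5 ^+ (k ^ 2).
Proof.
rewrite /lognormal size_polyXn big_ord_recr /= coefXn eqxx mul1r big1 ?add0r //.
by move=> i _; rewrite coefXn ltn_eqF ?mul0r.
Qed.

(** The functional is positive definite with a margin: rescaling the
    coefficients of [q] by [5^(2 i^2)] turns the Hankel matrix [5^((i+j)^2)]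
    into the Toeplitz kernel above.  It is this boundedness of the coefficients,
    which fails for measures with compact support, that lets a derivative at the
    origin be added without losing positivity. *)
Lemma lognormal_sqr_coef (R : realFieldType) (q : {poly R}) k :
  q`_k ^+ 2 <= 2 * lognormal (q * q).
Proof.
pose N := maxn (size q) k.+1.
have le_qN : (size q <= N)%N by rewrite leq_maxl.
have lt_kN : (k < N)%N by rewrite leq_maxr.
pose u i := q`_i * 5 ^+ (2 * i ^ 2).
have -> : lognormal (q * q) =
  \sum_(i < N) \sum_(j < N) 5^-1 ^+ (natdist i j ^ 2) * (u i * u j).
  have qE : q = \sum_(i < N) q`_i *: 'X^i.
    rewrite -poly_def; apply/polyP => i; rewrite coef_poly; case: ltnP => // Ni.
    by rewrite nth_default // (leq_trans le_qN).
  rewrite {1 2}qE mulr_suml linear_sum; apply: eq_bigr => i _.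
  rewrite mulr_sumr linear_sum; apply: eq_bigr => j _ /=.
  rewrite -scalerAl -scalerAr -exprD !linearZ /= lognormalXn /u.
  have e : ((i + j) ^ 2 + natdist i j ^ 2 = 2 * i ^ 2 + 2 * j ^ 2)%N.
    by rewrite /natdist; case: (leqP i j) => ij; nia.
  have h : (5 : R) ^+ ((i + j) ^ 2) =
      5^-1 ^+ (natdist i j ^ 2) * (5 ^+ (2 * i ^ 2) * 5 ^+ (2 * j ^ 2)).
    by rewrite -exprD -e exprD exprVn mulrC mulfK // expf_neq0.
  by rewrite h; ring.
apply: le_trans (_ : 2 * (\sum_(i < N) 2^-1 * u i ^+ 2) <= _); last first.
  rewrite ler_pM2l //; apply: le_trans (gaussian_toeplitz_ge N u).
  apply: ler_sum => i _; apply: ler_wpM2r; first exact: sqr_ge0.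
  by rewrite lerDl mulr_ge0 ?divr_ge0 // exprn_ge0 // invr_ge0.
rewrite -mulr_sumr mulVKf ?pnatr_eq0 // (bigD1 (Ordinal lt_kN)) //=.
apply: ler_wpDr; first by apply: sumr_ge0 => i _; exact: sqr_ge0.
by rewrite /u exprMn ler_peMr ?sqr_ge0 // exprn_ege1 // exprn_ege1 // ler1n.
Qed.

(** * Restriction to parametrized curves *)

(** The restriction of [f] to the parametrized curve [t |-> (u(t), v(t))]. *)
Definition pullback (R : realFieldType) (u v : {poly R}) (f : polyxy R) :
    {poly R} :=
  mmap (@polyC R) (tnth [tuple u; v]) f.

Lemma pullback_is_zmod_morphism (R : realFieldType) (u v : {poly R}) :
  zmod_morphism (pullback u v).
Proof. exact: mmap_is_additive. Qed.

Lemma pullback_is_monoid_morphism (R : realFieldType) (u v : {poly R}) :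
  monoid_morphism (pullback u v).
Proof.
by case: (@mmap_is_multiplicative 2 R {poly R} (tnth [tuple u; v]) (@polyC R)).
Qed.

Lemma pullback_is_scalable (R : realFieldType) (u v : {poly R}) :
  scalable (pullback u v).
Proof. by move=> c f; rewrite /pullback mmapZ mul_polyC. Qed.

HB.instance Definition _ (R : realFieldType) (u v : {poly R}) :=
  GRing.isZmodMorphism.Build (polyxy R) {poly R} (pullback u v)
    (pullback_is_zmod_morphism u v).
HB.instance Definition _ (R : realFieldType) (u v : {poly R}) :=
  GRing.isMonoidMorphism.Build (polyxy R) {poly R} (pullback u v)
    (pullback_is_monoid_morphism u v).
HB.instance Definition _ (R : realFieldType) (u v : {poly R}) :=
  GRing.isScalable.Build R (polyxy R) {poly R} *:%R (pullback u v)
    (@pullback_is_scalable R u v).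

Lemma pullback_varX (R : realFieldType) (u v : {poly R}) :
  pullback u v (varX R) = u.
Proof. by rewrite /pullback mmapX mmap1U. Qed.

Lemma pullback_varY (R : realFieldType) (u v : {poly R}) :
  pullback u v (varY R) = v.
Proof. by rewrite /pullback mmapX mmap1U. Qed.

Lemma pullback_mon (R : realFieldType) (u v : {poly R}) d (m : monomial d) :
  pullback u v (mon R m) = u ^+ expx m * v ^+ expy m.
Proof.
rewrite /pullback mmapX /mmap1 big_ord_recl big_ord1.
congr (_ * v ^+ _); rewrite /expy.
by congr (fun_of_multinom _ _); apply: val_inj.
Qed.

Lemma mon_expansion (R : realFieldType) (f : polyxy R) d :
  (msize f <= d.+1)%N ->
  f = \sum_(m : monomial d) mcoeff m f *: mon R m.
Proof. exact: mpolywE. Qed.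

(** * The functional *)

Definition branch_sum (R : realFieldType) (l1 l2 : nat) (f : polyxy R) : R :=
  lognormal (pullback 'X 0 f) + lognormal (pullback 0 'X f) +
  lognormal (pullback 'X^l2 'X^l1 f).

Definition jet_functional (R : realFieldType) (l1 l2 : nat) (eps : R)
    (f : polyxy R) : R :=
  6 / eps * (pullback 'X (- 'X) f)`_0 + (pullback 'X (- 'X) f)`_2 +
  eps * branch_sum l1 l2 f.

Lemma jet_functional_is_scalar (R : realFieldType) l1 l2 (eps : R) :
  scalar (jet_functional l1 l2 eps).
Proof.
move=> c f g; rewrite /jet_functional /branch_sum !linearP /= !coefD !coefZ.
by ring.
Qed.

HB.instance Definition _ (R : realFieldType) l1 l2 (eps : R) :=
  GRing.isLinear.Build R (polyxy R) R _ (jet_functional l1 l2 eps)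
    (@jet_functional_is_scalar R l1 l2 eps).

(** Along [t |-> (t^l2, t^l1)] the monomial [xy] shares its exponent with no
    other monomial, so the restriction of a polynomial to this curve remembers
    its coefficient of [xy]. *)
Lemma coprime_weight_eq (l1 l2 i j : nat) :
  (1 < l1)%N -> (1 < l2)%N -> coprime l1 l2 ->
  (l1 + l2 == l2 * i + l1 * j)%N = (i == 1%N) && (j == 1%N).
Proof.
move=> l1_gt1 l2_gt1 co_l; apply/eqP/andP => [e|[/eqP-> /eqP->]]; last by lia.
have i_gt0 : (0 < i)%N.
  case: i e => // e; have : (l1 %| l2)%N.
    by rewrite -(dvdn_addr _ (dvdnn l1)) e muln0 add0n dvdn_mulr.
  by move/gcdn_idPl; rewrite (eqP co_l) => l1E; rewrite -l1E in l1_gt1.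
have j_gt0 : (0 < j)%N.
  case: j e => // e; have : (l2 %| l1)%N.
    by rewrite -(dvdn_addl _ (dvdnn l2)) e muln0 addn0 dvdn_mulr.
  by move/gcdn_idPr; rewrite (eqP co_l) => l2E; rewrite -l2E in l2_gt1.
by split; apply/eqP; nia.
Qed.

(** The left side is the combination [c20 - c11 + c02] of the coefficients of
    [f], and each branch carries one of them. *)
Lemma antidiagonal_coef2 (R : realFieldType) l1 l2 (f : polyxy R) :
  (1 < l1)%N -> (1 < l2)%N -> coprime l1 l2 ->
  (pullback 'X (- 'X) f)`_2 =
  (pullback 'X 0 f)`_2 + (pullback 0 'X f)`_2 -
  (pullback 'X^l2 'X^l1 f)`_(l1 + l2).
Proof.
move=> l1_gt1 l2_gt1 co_l.
rewrite (@mon_expansion _ f (msize f)) // !linear_sum !coef_sum /= -big_split.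
rewrite -sumrB; apply: eq_bigr => m _ /=.
rewrite !linearZ /= !coefZ -mulrDr -mulrBr; congr (_ * _).
rewrite !pullback_mon; move: (expx m) (expy m) => i j.
rewrite -!exprM -exprD coefXn coprime_weight_eq // exprNn.
rewrite -polyCN -polyC_exp mulrCA coefCM -exprD coefXn.
rewrite -(polyC_exp i 0) -(polyC_exp j 0) (mulrC 'X^i) !coefCM !coefXn !expr0n.
case: i => [|[|[|i]]]; case: j => [|[|[|j]]] //=;
  rewrite ?addSn ?addnS /= ?expr0 ?expr1; try ring.
Qed.

(** The branch terms vanish because [p] does on each branch, and the jet terms
    because [p(t,-t)] is divisible by [t^4]. *)
Lemma jet_functional_ideal (R : realFieldType) l1 l2 (eps : R) (h : polyxy R) :
  (1 < l1)%N -> (1 < l2)%N ->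
  jet_functional l1 l2 eps
    (varX R * varY R * (varX R ^+ l1 - varY R ^+ l2) * h) = 0.
Proof.
move=> l1_gt1 l2_gt1.
rewrite /jet_functional /branch_sum !rmorphM !rmorphB !rmorphXn /=.
rewrite !pullback_varX !pullback_varY !(mul0r, mulr0) -!exprM mulnC subrr.
rewrite !(mul0r, mulr0) !linear0 !addr0 mulr0 addr0.
have -> : 'X * - 'X * ('X ^+ l1 - (- 'X) ^+ l2) =
    'X^4 * - ('X^(l1 - 2) - (- 'X) ^+ (l2 - 2)) :> {poly R}.
  rewrite -{1}(subnK l1_gt1) -{1}(subnK l2_gt1) !exprD sqrrN; ring.
by rewrite -(mulrA 'X^4) !coefXnM mulr0 addr0.
Qed.

(** With [g(t,-t) = q0 + q1 t + w t^2 + ...], the value at [g^2] is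
    [(6/eps) q0^2 + 2 q0 w + q1^2] plus [eps] times the branch terms.  The
    latter are at least [w^2 / 6], [w] being a signed sum of three coefficients,
    and the constant [6/eps] is what completes the square in [q0]. *)
Lemma jet_functional_sqr_ge0 (R : realFieldType) l1 l2 (eps : R)
    (g : polyxy R) :
  (1 < l1)%N -> (1 < l2)%N -> coprime l1 l2 -> 0 < eps ->
  0 <= jet_functional l1 l2 eps (g * g).
Proof.
move=> l1_gt1 l2_gt1 co_l eps_gt0.
rewrite /jet_functional /branch_sum !rmorphM /=.
have := antidiagonal_coef2 g l1_gt1 l2_gt1 co_l.
have := lognormal_sqr_coef (pullback 'X 0 g) 2.
have := lognormal_sqr_coef (pullback 0 'X g) 2.
have := lognormal_sqr_coef (pullback 'X^l2 'X^l1 g) (l1 + l2).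
move: (lognormal _) (lognormal _) (lognormal _) => C B A.
rewrite !coefM !big_ord_recr !big_ord0 /=.
move: (pullback 'X (- 'X) g) => q.
move: (_`_2) (_`_2) (_`_(l1 + l2)).
move=> a b c cC bB aA ->.
set q0 := q`_0; set w := a + b - c.
have -> : 6 / eps * (0 + q0 * q0) + (0 + q0 * w + q`_1 * q`_1 + w * q0) +
    eps * (C + B + A) =
  6 / eps * (q0 + eps * w / 6) ^+ 2 + q`_1 ^+ 2 +
    eps * (C + B + A - w ^+ 2 / 6).
  by field; rewrite gt_eqF.
have w6 : 0 <= C + B + A - w ^+ 2 / 6.
  rewrite /w; have := sqr_ge0 (a - b); have := sqr_ge0 (a + c).
  have := sqr_ge0 (b + c); nra.
have eps_ge0 := ltW eps_gt0.
apply: addr_ge0; last exact: mulr_ge0.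
apply: addr_ge0; last exact: sqr_ge0.
by apply: mulr_ge0; rewrite ?sqr_ge0 ?divr_ge0 ?ler0n.
Qed.

(** * Truncations of a linear functional *)

Definition moments (R : realFieldType) (L : {scalar polyxy R}) (d : nat) :
    truncseq R d :=
  [ffun m => L (mon R m)].

Lemma riesz_moments (R : realFieldType) (L : {scalar polyxy R}) d f :
  (msize f <= d.+1)%N -> riesz (moments L d) f = L f.
Proof.
move=> /mon_expansion {2}->; rewrite linear_sum /=; apply: eq_bigr => m _.
by rewrite ffunE linearZ.
Qed.

Lemma msize_mul_mon (R : realFieldType) (f : polyxy R) d1 d2
    (m1 : monomial d1) (m2 : monomial d2) :
  (msize (f * mon R m1 * mon R m2) <= (totdeg f + d1 + d2).+1)%N.
Proof.
rewrite -mulrA -mpolyXD; have [->|f_neq0] := eqVneq f 0.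
  by rewrite mul0r msize0.
have X_neq0 : mpolyX R (mnm_add m1 m2) != 0 by rewrite -msize_poly_eq0 msizeX.
rewrite msizeM // msizeX mdegD.
rewrite /totdeg -{1}[msize f]prednK ?lt0n ?msize_poly_eq0 //= addnS ltnS.
by rewrite -addnA leq_add2l leq_add // -ltnS bmdeg.
Qed.

Lemma msize_mon_mul_mon (R : realFieldType) d (m1 m2 : monomial d) :
  (msize (mon R m1 * mon R m2) <= (d.*2).+1)%N.
Proof.
by have := @msize_mul_mon R 1 _ _ m1 m2; rewrite mul1r /totdeg msize1 -addnn.
Qed.

Lemma psd_momentmx_moments (R : realFieldType) (L : {scalar polyxy R}) n :
  (forall g, 0 <= L (g * g)) -> psd (momentmx (moments L n.*2)).
Proof.
move=> L_ge0; split; first by apply/matrixP => i j; rewrite !mxE mulrC.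
move=> v; pose g := \sum_i v i 0 *: mon R (enum_val i).
suff -> : (v^T *m momentmx (moments L n.*2) *m v) 0 0 = L (g * g) by [].
rewrite mxE {2}/g mulr_sumr linear_sum; apply: eq_bigr => j _ /=.
rewrite mxE !mulr_suml linear_sum; apply: eq_bigr => i _ /=.
rewrite !mxE riesz_moments ?msize_mon_mul_mon //.
have mulZ (a b : R) (f h : polyxy R) : (a *: f) * (b *: h) = (a * b) *: (f * h).
  by rewrite -scalerAl -scalerAr scalerA.
by rewrite mulZ [RHS]linearZ /= mulrAC.
Qed.

Lemma psd_localmx_moments (R : realFieldType) (L : {scalar polyxy R}) n f :
  (forall h, L (f * h) = 0) -> (uphalf (totdeg f) <= n)%N ->
  psd (localmx (moments L n.*2) f).
Proof.
move=> Lf deg_f.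
have -> : localmx (moments L n.*2) f = 0.
  apply/matrixP => i j; rewrite !mxE riesz_moments ?mulrA -?mulrA ?Lf //.
  rewrite mulrA (leq_trans (msize_mul_mon _ _ _)) // /locsize; lia.
by split=> [|v]; rewrite ?trmx0 // mulmx0 mul0mx mxE.
Qed.

Lemma mxsub_momentmx_moments (R : realFieldType) (L : {scalar polyxy R}) n k :
  mxsub (@widen_index n k) (@widen_index n k) (momentmx (moments L (n + k).*2))
  = momentmx (moments L n.*2).
Proof.
apply/matrixP => i j.
by rewrite !mxE !enum_rankK !riesz_moments ?msize_mon_mul_mon.
Qed.

(** A functional on all polynomials provides the extensions of all orders at
    once, its truncations being compatible; as it kills the multiples of [p],
    both localizing matrices are zero. *)
Lemma extension_property_moments (R : realFieldType) (L : {scalar polyxy R})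
    (p : polyxy R) n :
  (forall g, 0 <= L (g * g)) -> (forall h, L (p * h) = 0) ->
  (uphalf (totdeg p) <= n)%N ->
  forall k, extension_property p (moments L n.*2) k.
Proof.
move=> L_ge0 Lp deg_p k; exists (moments L (n + k).*2).
have deg_pk : (uphalf (totdeg p) <= n + k)%N.
  by rewrite (leq_trans deg_p) ?leq_addr.
split; last 2 first.
- exact: psd_localmx_moments.
- apply: psd_localmx_moments; last by rewrite /totdeg msizeN.
  by move=> h; rewrite mulNr linearN Lp oppr0.
split; first exact: psd_momentmx_moments.
exact: mxsub_momentmx_moments.
Qed.

(** * Measures and nonnegative polynomials *)

Lemma evalxy_expansion (R : realFieldType) (f : polyxy R) d (a : R * R) :
  (msize f <= d.+1)%N ->
  evalxy f a =
  \sum_(m : monomial d) mcoeff m f * (a.1 ^+ expx m * a.2 ^+ expy m).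
Proof.
move=> deg_f; rewrite {1}(mon_expansion deg_f) /evalxy linear_sum /=.
apply: eq_bigr => m _; rewrite mevalZ mevalX big_ord_recl big_ord1.
congr (_ * (_ * _ ^+ _)); rewrite /expy.
by congr (fun_of_multinom _ _); apply: val_inj.
Qed.


Local Open Scope classical_set_scope.

Lemma evalxy_continuous (R : realType) (f : polyxy R) :
  continuous (evalxy f).
Proof.
have -> : evalxy f = fun a => \sum_(m : monomial (msize f))
    mcoeff m f * (a.1 ^+ expx m * a.2 ^+ expy m).
  by apply/funext => a; apply: evalxy_expansion.
have fstX i : continuous (fun a : R * R => a.1 ^+ i).
  move=> a; apply: (@continuous_comp _ _ _ (fst : R * R -> R)
    (@GRing.exp R ^~ i)).
    exact: cvg_fst.
  exact: exprn_continuous.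
have sndX i : continuous (fun a : R * R => a.2 ^+ i).
  move=> a; apply: (@continuous_comp _ _ _ (snd : R * R -> R)
    (@GRing.exp R ^~ i)).
    exact: cvg_snd.
  exact: exprn_continuous.
apply: continuous_big => [|m _ a]; first exact: add_continuous.
apply: cvgM; first exact: cvg_cst.
apply: cvgM; first exact: (fstX (expx m)).
exact: (sndX (expy m)).
Qed.

Lemma measurable_zerosetC (R : realType) (p : polyxy R) :
  measurable (~` zeroset p : set (borel2 R)).
Proof.
apply: sub_sigma_algebra.
have -> : ~` zeroset p = evalxy p @^-1` [set x | x != 0].
  by apply/seteqP; split=> a /= /eqP.
apply: open_comp => [a _|]; first exact: evalxy_continuous.
exact: open_neq.
Qed.

(** [f] agrees with its absolute value almost everywhere, so its integral, which
    is the value of the Riesz functional, is nonnegative. *)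
Lemma representing_measure_riesz_ge0 (R : realType) (n : nat)
    (p : polyxy R) (b : truncseq R n.*2)
    (mu : {measure set (borel2 R) -> \bar R}) (f : polyxy R) :
  representing_measure p b mu -> (msize f <= (n.*2).+1)%N ->
  (forall a, zeroset p a -> 0 <= evalxy f a) -> 0 <= riesz b f.
Proof.
move=> [muZ b_mu] deg_f f_ge0.
pose mono (m : monomial n.*2) (a : borel2 R) : \bar R :=
  (a.1 ^+ expx m * a.2 ^+ expy m)%:E.
have int_m (m : monomial n.*2) :
    mu.-integrable setT (fun a => (mcoeff m f)%:E * mono m a)%E.
  by apply: integrableZl => //; exact: (b_mu m).1.
have fE : (fun a : borel2 R => (evalxy f a)%:E) =
    (fun a => \sum_(m : monomial n.*2) (mcoeff m f)%:E * mono m a)%E.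
  apply/funext => a; rewrite (evalxy_expansion _ deg_f) -sumEFin.
  by apply: eq_bigr => m _; rewrite EFinM.
have int_f : mu.-integrable setT (fun a : borel2 R => (evalxy f a)%:E).
  by rewrite fE; apply: integrable_sum.
rewrite -lee_fin.
have -> : (riesz b f)%:E = (\int[mu]_a (evalxy f a)%:E)%E.
  rewrite fE integral_sum // -sumEFin; apply: eq_bigr => m _.
  by rewrite integralZl // ?EFinM ?(b_mu m).2 //; exact: (b_mu m).1.
rewrite (ae_eq_integral (fun a : borel2 R => `|(evalxy f a)%:E|%E)) //.
- exact: integral_ge0.
- exact: measurable_int int_f.
- exact: measurable_int (integrable_abse int_f).
exists (~` zeroset p); split => //; first exact: measurable_zerosetC.
apply: subsetC => a /= pa _ /=.
by rewrite ger0_norm ?f_ge0.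
Qed.

(** * The separating polynomial *)

Lemma msize_mul_leq (R : realFieldType) (f g : polyxy R) d e :
  (msize f <= d.+1)%N -> (msize g <= e.+1)%N -> (msize (f * g) <= (d + e).+1)%N.
Proof.
move=> deg_f deg_g.
have [->|f_neq0] := eqVneq f 0; first by rewrite mul0r msize0.
have [->|g_neq0] := eqVneq g 0; first by rewrite mulr0 msize0.
rewrite msizeM // -subn1 leq_subLR addSn add0n -addnS -addSn.
exact: leq_add.
Qed.

Lemma msize_exp_leq (R : realFieldType) (f : polyxy R) k :
  (msize f <= 2)%N -> (msize (f ^+ k) <= k.+1)%N.
Proof.
move=> deg_f; elim: k => [|k IH]; first by rewrite expr0 msize1.
by rewrite exprS; apply: (@msize_mul_leq _ _ _ 1 k).
Qed.

Lemma msize_add_leq (R : realFieldType) (f g : polyxy R) d :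
  (msize f <= d)%N -> (msize g <= d)%N -> (msize (f + g) <= d)%N.
Proof.
by move=> deg_f deg_g; rewrite (leq_trans (msizeD_le _ _)) // geq_max deg_f.
Qed.

Lemma msize_varX (R : realFieldType) : (msize (varX R) <= 2)%N.
Proof. by rewrite msizeX mdeg1. Qed.

Lemma msize_varY (R : realFieldType) : (msize (varY R) <= 2)%N.
Proof. by rewrite msizeX mdeg1. Qed.

Lemma msize_curve (R : realFieldType) l1 l2 d :
  (l1 <= d)%N -> (l2 <= d)%N ->
  (msize (varX R * varY R * (varX R ^+ l1 - varY R ^+ l2)) <= d.+3)%N.
Proof.
move=> le_l1 le_l2; apply: (@msize_mul_leq _ _ _ 2 d).
  by apply: (@msize_mul_leq _ _ _ 1 1); [exact: msize_varX|exact: msize_varY].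
apply: msize_add_leq; rewrite ?msizeN.
  exact: leq_trans (msize_exp_leq _ (msize_varX R)) _.
exact: leq_trans (msize_exp_leq _ (msize_varY R)) _.
Qed.

(** The constant [9^(l1+l2)] is chosen so that the quartic term takes over
    outside the disc of radius [3^-(l1+l2)]; inside it each branch is already
    close enough to its tangent axis. *)
Definition separating_poly (R : realFieldType) (l1 l2 : nat) : polyxy R :=
  varX R ^+ 2 + varY R ^+ 2 + 3 *: (varX R * varY R) +
  9 ^+ (l1 + l2) *: (varX R ^+ 4 + varY R ^+ 4).

Lemma msize_separating_poly (R : realFieldType) l1 l2 :
  (msize (separating_poly R l1 l2) <= 5)%N.
Proof.
have Xk k : (k <= 4)%N -> (msize (varX R ^+ k) <= 5)%N.
  by move=> k4; apply: leq_trans (msize_exp_leq _ (msize_varX R)) _.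
have Yk k : (k <= 4)%N -> (msize (varY R ^+ k) <= 5)%N.
  by move=> k4; apply: leq_trans (msize_exp_leq _ (msize_varY R)) _.
apply: msize_add_leq; last first.
  by apply: leq_trans (msizeZ_le _ _) _; rewrite msize_add_leq ?Xk ?Yk.
apply: msize_add_leq; first by rewrite msize_add_leq ?Xk ?Yk.
apply: leq_trans (msizeZ_le _ _) _.
by apply: leq_trans (@msize_mul_leq _ _ _ 1 1 (msize_varX R) (msize_varY R)) _.
Qed.

Lemma evalxy_curve (R : realFieldType) l1 l2 (a : R * R) :
  evalxy (varX R * varY R * (varX R ^+ l1 - varY R ^+ l2)) a =
  a.1 * a.2 * (a.1 ^+ l1 - a.2 ^+ l2).
Proof. by rewrite /evalxy !rmorphM rmorphB !rmorphXn /= !mevalXU. Qed.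

Lemma evalxy_separating_poly (R : realFieldType) l1 l2 (a : R * R) :
  evalxy (separating_poly R l1 l2) a =
  a.1 ^+ 2 + a.2 ^+ 2 + 3 * (a.1 * a.2) +
  9 ^+ (l1 + l2) * (a.1 ^+ 4 + a.2 ^+ 4).
Proof.
by rewrite /evalxy !(mevalD, mevalZ) !rmorphXn mevalM /= !mevalXU.
Qed.

(** Since [|x|^l1 = |y|^l2 <= |y|^l1 |y|] when [|y| <= 1], the ratio
    [|x|/|y|] is at most the [l1]-th root of [|y|]: the curve is tangent to the axis [x = 0]. *)
Lemma branch_contact (R : realFieldType) l1 l2 (x y : R) :
  (0 < l1)%N -> (l1 < l2)%N -> x ^+ l1 = y ^+ l2 -> `|y| <= 3^-1 ^+ l1 ->
  `|x| <= `|y| / 3.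
Proof.
move=> l1_gt0 lt_l xy y_small.
have y_le1 : `|y| <= 1.
  by rewrite (le_trans y_small) // exprn_ile1 ?invr_ge0 ?invf_le1 ?ler1n.
rewrite -(@ler_pXn2r _ l1) ?nnegrE ?divr_ge0 ?ler0n // -normrX xy normrX.
apply: (@le_trans _ _ (`|y| ^+ l1.+1)); first exact: ler_wiXn2l.
by rewrite exprSr exprMn ler_wpM2l // exprn_ge0.
Qed.

Lemma quadratic_part_ge0 (R : realFieldType) (x y : R) :
  `|x| <= `|y| / 3 -> 0 <= x ^+ 2 + y ^+ 2 + 3 * (x * y).
Proof.
move=> le_xy; have := lerNnormlW (lexx `|x * y|); rewrite normrM => xy_ge.
have := real_normK (num_real y); have := sqr_ge0 x.
have := normr_ge0 x; have := normr_ge0 y; nra.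
Qed.

(** On the axes the cross term vanishes.  On the curve, outside the disc
    [x^2 + y^2 < 9^-(l1+l2)] the quartic term is at least [(x^2 + y^2) / 2],
    which makes the sum at least [(3/2) (x + y)^2]; inside, tangency to an axis
    bounds the cross term by the square of one coordinate. *)
Lemma separating_poly_ge0 (R : realFieldType) l1 l2 (a : R * R) :
  (1 < l1)%N -> (1 < l2)%N -> coprime l1 l2 ->
  evalxy (varX R * varY R * (varX R ^+ l1 - varY R ^+ l2)) a = 0 ->
  0 <= evalxy (separating_poly R l1 l2) a.
Proof.
move=> l1_gt1 l2_gt1 co_l; rewrite evalxy_curve evalxy_separating_poly.
case: a => x y /=; set M : R := 9 ^+ _.
have M_gt0 : 0 < M by rewrite exprn_gt0.
have quart_ge0 : 0 <= M * (x ^+ 4 + y ^+ 4).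
  by apply: mulr_ge0; [exact: ltW|rewrite addr_ge0 ?exprn_even_ge0].
suff quad : x * y = 0 \/ x ^+ l1 = y ^+ l2 ->
    0 <= x ^+ 2 + y ^+ 2 + 3 * (x * y) + M * (x ^+ 4 + y ^+ 4).
  move=> /eqP; rewrite mulf_eq0 subr_eq0 => /orP[/eqP xy0|/eqP xy].
  - by apply: quad; left.
  - by apply: quad; right.
case=> [->|xy].
  by rewrite mulr0 addr0 !addr_ge0 ?sqr_ge0.
have [far|near] := leP (M^-1) (x ^+ 2 + y ^+ 2).
  have {far} far : 1 <= M * (x ^+ 2 + y ^+ 2).
    by rewrite -(mulfV (lt0r_neq0 M_gt0)) ler_pM2l.
  have := sqr_ge0 (x + y); have := sqr_ge0 (x ^+ 2 - y ^+ 2).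
  have := sqr_ge0 x; have := sqr_ge0 y.
  nra.
have small (z : R) k : (k <= l1 + l2)%N -> z ^+ 2 <= x ^+ 2 + y ^+ 2 ->
    `|z| <= 3^-1 ^+ k.
  move=> le_k le_z; apply: (@le_trans _ _ (3^-1 ^+ (l1 + l2))).
    rewrite -(@ler_pXn2r _ 2) ?nnegrE ?exprn_ge0 ?invr_ge0 //.
    rewrite real_normK ?num_real // (le_trans le_z) // (le_trans (ltW near)) //.
    rewrite -exprM mulnC exprM exprVn /M exprVn.
    by have -> : 9 = 3 ^+ 2 :> R by rewrite -natrX.
  by apply: ler_wiXn2l => //; rewrite ?invr_ge0 ?invf_le1 ?ler1n.
have x2 := sqr_ge0 x; have y2 := sqr_ge0 y.
apply: addr_ge0 => //.
have /orP[lt_l|lt_l] : ((l1 < l2) || (l2 < l1))%N.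
  rewrite -neq_ltn; apply: contraTneq co_l => ->.
  by rewrite /coprime gcdnn; case: eqP => // e; rewrite e in l2_gt1.
- have {}xy : `|x| <= `|y| / 3.
    apply: branch_contact xy _ => //; first exact: ltnW.
    by apply: small; rewrite ?leq_addr ?lerDr.
  exact: quadratic_part_ge0.
- have {}xy : `|y| <= `|x| / 3.
    apply: (@branch_contact _ l2 l1) => //; first exact: ltnW.
    by apply: small; rewrite ?leq_addl ?lerDl.
  by rewrite (addrC (x ^+ 2)) (mulrC x) quadratic_part_ge0.
Qed.

(** On the antidiagonal the polynomial reads [-t^2 + 2 * 9^(l1+l2) t^4], so its
    point evaluation is [0] and its jet term is [-1]. *)
Lemma jet_functional_separating_poly_lt0 (R : realFieldType) l1 l2 (eps : R) :
  eps * branch_sum l1 l2 (separating_poly R l1 l2) < 1 ->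
  jet_functional l1 l2 eps (separating_poly R l1 l2) < 0.
Proof.
move=> small; rewrite /jet_functional.
have -> : pullback 'X (- 'X) (separating_poly R l1 l2) =
    - 'X^2 + (9 ^+ (l1 + l2) *+ 2) *: 'X^4.
  rewrite /separating_poly !rmorphD /= !linearZ !rmorphXn rmorphD !rmorphXn.
  rewrite rmorphM /=.
  rewrite pullback_varX pullback_varY -!mul_polyC rmorph_nat rmorphMn /=.
  by move: (_ ^+ _)%:P => M; ring.
rewrite !coefD !coefN !coefZ !coefXn /= !mulr0 !addr0 oppr0 mulr0 add0r.
by rewrite addrC subr_lt0.
Qed.

(** * The theorem *)

Theorem theorem3p6 (R : realType) (l1 l2 : nat)
    (hl1 : (2 <= l1)%N) (hl2 : (2 <= l2)%N) (hl : gcdn l1 l2 = 1%N)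
    (n : nat) (hn : (maxn (l1 + 2) (l2 + 2) <= n)%N) :
  let p : polyxy R := varX R * varY R * (varX R ^+ l1 - varY R ^+ l2) in
  exists b : truncseq R n.*2,
    (forall k : nat, extension_property p b k) /\
    ~ (exists mu : {measure set (borel2 R) -> \bar R},
         representing_measure p b mu).
Proof.
move=> p; have co_l : coprime l1 l2 by apply/eqP.
(* The branch functionals are weighted so as to contribute less than 1 at the
   separating polynomial, whose jet term is -1. *)
pose V := branch_sum l1 l2 (separating_poly R l1 l2); pose eps := (`|V| + 1)^-1.
have V1_gt0 : 0 < `|V| + 1 by rewrite ltr_wpDl.
have eps_gt0 : 0 < eps by rewrite invr_gt0.
have small : eps * V < 1.
  by rewrite mulrC ltr_pdivrMr // mul1r (le_lt_trans (ler_norm _)) // ltrDl.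
exists (moments (jet_functional l1 l2 eps) n.*2); split.
  apply: extension_property_moments => [g|h|].
  - exact: jet_functional_sqr_ge0.
  - exact: jet_functional_ideal.
  have := @msize_curve R l1 l2 (n - 2); rewrite -/p /totdeg; lia.
have deg_f : (msize (separating_poly R l1 l2) <= (n.*2).+1)%N.
  by apply: leq_trans (msize_separating_poly R l1 l2) _; lia.
case=> mu /representing_measure_riesz_ge0 /(_ deg_f) f_ge0.
have /f_ge0 : forall a, zeroset p a -> 0 <= evalxy (separating_poly R l1 l2) a.
  by move=> a; apply: separating_poly_ge0.
rewrite riesz_moments //.
by rewrite leNgt jet_functional_separating_poly_lt0.
Qed.
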